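(* Let $\{d_n\}_1^\infty$ be a sequence of positive numbers, $c>0$, and let $\alpha=\{\alpha_n\}_1^\infty\subset\mathbb C^{p\times p}$ be selfadjoint matrices. Let $\mathbf J_{X,\alpha}$ be the block Jacobi matrix with diagonal entries $\mathcal A_0=\mathbb O_p$, $\mathcal A_{2j}=\frac{\alpha_j}{d_{j+1}}$ ($j\ge1$), $\mathcal A_{2j+1}=-\frac{\nu(d_{j+1})}{d_{j+1}^2}\mathbb I_p$ ($j\ge0$), and off-diagonal entries $\mathcal B_{2j}=\frac{\nu(d_{j+1})}{d_{j+1}^2}\mathbb I_p$, $\mathcal B_{2j+1}=\frac{\nu(d_{j+1})}{d_{j+1}^{3/2}d_{j+2}^{1/2}}\mathbb I_p$ ($j\ge0$), where $\nu(x)=\frac{cx}{\sqrt{1+c^2x^2}}$. Let $\mathcal C_0:=(\mathcal B_1^* )^{-1}$, $\mathcal C_1:=\mathbb I_p$, and for $j\in\mathbb N$ $$\mathcal C_{2j}=(-1)^j\mathcal B_{2j-1}^{-1}\mathcal B_{2j-2}^*\cdots\mathcal B_2^*\mathcal B_1^{-1},\qquad\mathcal C_{2j+1}=(-1)^j\mathcal B_{2j}^{-1}\mathcal B_{2j-1}^*\cdots\mathcal B_2^{-1}\mathcal B_1^* .$$ Then the series $\sum_{n=1}^{+\infty}\|\mathcal C_n^*\mathcal A_n\mathcal C_n\|$ diverges; hence $\mathbf J_{X,\alpha}$ does not meet the Kostyuchenko–Mirzoev conditions $$\sum_{n=1}^{+\infty}\|\mathcal C_n\|^2<+\infty\quad\text{and}\quad\sum_{n=1}^{+\infty}\|\mathcal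 C_n^*\mathcal A_n\mathcal C_n\|<+\infty .$$
   Context: Here $d_n=x_n-x_{n-1}$ for a strictly increasing sequence $X=\{x_n\}_{n\ge0}$ with $x_0=0$. In a block Jacobi matrix, $\mathcal A_n$ stands on the main diagonal, $\mathcal B_n$ directly above it (row $n$, column $n+1$) and $\mathcal B_n^*$ directly below it, $n\in\mathbb N_0$. In the products defining $\mathcal C_n$ the indices of the factors decrease by one from left to right down to $1$, with inverses and adjoints alternating (e.g. $\mathcal C_2=-\mathcal B_1^{-1}$, $\mathcal C_3=-\mathcal B_2^{-1}\mathcal B_1^*$). $\mathbb I_p,\mathbb O_p$ are the identity and zero $p\times p$ matrices; norms are operator norms. *)

(* Defs.v *)
From HB Require Import structures.
From mathcomp Require Import all_boot all_order all_algebra.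
From mathcomp Require Import spectral complex.
From mathcomp Require Import all_classical all_reals all_analysis.

Set Implicit Arguments.
Unset Strict Implicit.
Unset Printing Implicit Defensive.

Import Order.TTheory GRing.Theory Num.Theory.
Import numFieldNormedType.Exports.

Local Open Scope ring_scope.
Local Open Scope classical_set_scope.
Local Open Scope complex_scope.
Local Open Scope sesquilinear_scope.

Definition l2norm (R : realType) (p : nat) (v : 'cV[R[i]]_p) : R :=
  Num.sqrt (\sum_(i < p) ComplexField.Normc.normc (v i 0) ^+ 2).

(* Operator norm on C^p with the Euclidean norm; the set is nonempty and
   bounded, so the real-valued [sup] is the genuine supremum. *)
Definition opnorm (R : realType) (p : nat) (M : 'M[R[i]]_p) : R :=
  sup [set l2norm (M *m v) | v in [set v : 'cV[R[i]]_p | l2norm v <= 1]].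

(* Infinite matrices with p x p blocks: [J m n] is the block in row m and
   column n. *)
Definition block_matrix (R : realType) (p : nat) := nat -> nat -> 'M[R[i]]_p.

Definition block_jacobi (R : realType) (p : nat) (A B : nat -> 'M[R[i]]_p) :
    block_matrix R p := fun m n =>
  if m == n then A m
  else if n == m.+1 then B m
  else if m == n.+1 then (B n)^t*
  else 0.

Definition diag_block (R : realType) (p : nat) (J : block_matrix R p) (n : nat) :=
  J n n.

Definition super_block (R : realType) (p : nat) (J : block_matrix R p) (n : nat) :=
  J n n.+1.

(* The noncommutative product over k = n-1, n-2, ..., 1 (in this order from
   left to right) of factors that alternate between B_k^{-1} and B_k^*,
   starting with B_{n-1}^{-1}; hence B_k is inverted iff n - k is odd. *)
Definition alt_prod (R : realType) (p : nat) (B : nat -> 'M[R[i]]_p) (n : nat) :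
    'M[R[i]]_p :=
  \big[mulmx/1%:M]_(k <- rev (index_iota 1 n))
    (if odd (n - k) then invmx (B k) else (B k)^t*).

(* For n = 1 the product is empty and n./2 = 0, so C_1 is the identity. *)
Definition KM_C (R : realType) (p : nat) (J : block_matrix R p) (n : nat) :
    'M[R[i]]_p :=
  if n == 0%N then invmx ((super_block J 1)^t*)
  else (-1) ^+ n./2 *: alt_prod (super_block J) n.

Definition KM_term (R : realType) (p : nat) (J : block_matrix R p) (n : nat) : R :=
  opnorm ((KM_C J n)^t* *m diag_block J n *m KM_C J n).

Definition Kostyuchenko_Mirzoev (R : realType) (p : nat) (J : block_matrix R p) :
    Prop :=
  (\sum_(1 <= n <oo) ((opnorm (KM_C J n)) ^+ 2)%:E < +oo)%E /\
  (\sum_(1 <= n <oo) (KM_term J n)%:E < +oo)%E.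

Definition nu (R : realType) (c x : R) : R :=
  c * x / Num.sqrt (1 + c ^+ 2 * x ^+ 2).

(* For n = 2j or n = 2j+1, j is n./2. The values d 0 and alpha 0 are unused. *)
Definition J_diag (R : realType) (p : nat) (c : R) (d : nat -> R)
    (alpha : nat -> 'M[R[i]]_p) (n : nat) : 'M[R[i]]_p :=
  let j := n./2 in
  if n == 0%N then 0
  else if odd n then (- (nu c (d j.+1) / d j.+1 ^+ 2))%:C%:M
  else ((d j.+1)^-1)%:C *: alpha j.

Definition J_offdiag (R : realType) (p : nat) (c : R) (d : nat -> R) (n : nat) :
    'M[R[i]]_p :=
  let j := n./2 in
  if odd n then
    (nu c (d j.+1) / (d j.+1 `^ (3 / 2) * d j.+2 `^ (1 / 2)))%:C%:M
  else (nu c (d j.+1) / d j.+1 ^+ 2)%:C%:M.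

Definition J_X_alpha (R : realType) (p : nat) (c : R) (d : nat -> R)
    (alpha : nat -> 'M[R[i]]_p) : block_matrix R p :=
  block_jacobi (J_diag c d alpha) (J_offdiag p c d).

(* Main.v *)
Require Import Defs.
From HB Require Import structures.
From mathcomp Require Import all_boot all_order all_algebra.
From mathcomp Require Import spectral complex.
From mathcomp Require Import all_classical all_reals all_analysis.
From mathcomp Require Import zify ring lra.

Set Implicit Arguments.
Unset Strict Implicit.
Unset Printing Implicit Defensive.

Import Order.TTheory GRing.Theory Num.Theory.
Import numFieldNormedType.Exports.

Local Open Scope ring_scope.
Local Open Scope classical_set_scope.
Local Open Scope complex_scope.

(** The terms of odd index alone keep the series from converging: they are
    bounded below by a positive constant.

    Every off-diagonal block is a real multiple of the identity, so
    [C_{2j+1}] is the scalar [(-1)^j] times the product of the ratios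
    [B_{2i-1} / B_{2i}], [1 <= i <= j].  With [q_i = nu (d_i) / d_i^{3/2}] each
    ratio is [q_i / q_{i+1}], so the product telescopes to [q_1 / q_{j+1}]
    ([alt_prod_scalar], [offdiag_prod]).  The diagonal block [A_{2j+1}] is the
    scalar [- nu (d_{j+1}) / d_{j+1}^2], hence ([KM_term_odd])

      [ ||C_{2j+1}^* A_{2j+1} C_{2j+1}|| = q_1^2 * d_{j+1} / nu (d_{j+1}) ].

    Finally [x / nu x = sqrt (1 + c^2 x^2) / c >= 1 / c] ([div_nu_ge]), whatever
    the sequence [d] is.  The failure of the Kostyuchenko-Mirzoev conditions
    follows because a series of nonnegative terms with finite sum converges. *)

Lemma normc_real (R : realType) (a : R) : ComplexField.Normc.normc a%:C = `|a|.
Proof. by rewrite /ComplexField.Normc.normc /= expr0n addr0 sqrtr_sqr. Qed.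

Lemma l2norm_scalar (R : realType) (p : nat) (a : R) (v : 'cV[R[i]]_p) :
  l2norm (a%:C%:M *m v) = `|a| * l2norm v.
Proof.
rewrite /l2norm -[`|a|]sqrtr_sqr -sqrtrM ?sqr_ge0// mulr_sumr.
congr Num.sqrt; apply: eq_bigr => i _.
by rewrite mul_scalar_mx mxE ComplexField.Normc.normcM normc_real exprMn
  real_normK ?num_real.
Qed.

Lemma l2norm0 (R : realType) (p : nat) : l2norm (0 : 'cV[R[i]]_p) = 0.
Proof.
rewrite /l2norm big1 ?sqrtr0// => i _.
by rewrite mxE ComplexField.Normc.normc0 expr0n.
Qed.

Lemma l2norm_delta (R : realType) (p : nat) (k : 'I_p) :
  l2norm (delta_mx k 0 : 'cV[R[i]]_p) = 1.
Proof.
rewrite /l2norm (bigD1 k)//= big1 ?addr0 => [|i /negPf ik]; rewrite mxE.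
  by rewrite !eqxx ComplexField.Normc.normc1 expr1n sqrtr1.
by rewrite ik ComplexField.Normc.normc0 expr0n.
Qed.

Lemma opnorm_ge0 (R : realType) (p : nat) (M : 'M[R[i]]_p) : 0 <= opnorm M.
Proof.
rewrite /opnorm; set E := [set _ | _ in _].
have E0 : E 0 by exists 0; rewrite ?mulmx0 /= l2norm0.
(* The supremum of an unbounded set of reals is 0 by convention, so no bound
   on E has to be exhibited. *)
have [hE|/sup_out ->//] := pselect (has_sup E).
by apply: ub_le_sup => //; case: hE.
Qed.

(** The hypothesis [0 < p] supplies a unit vector; on the zero space every
    operator norm vanishes. *)
Lemma opnorm_scalar (R : realType) (p : nat) (a : R) : (0 < p)%N ->
  opnorm (a%:C%:M : 'M[R[i]]_p) = `|a|.
Proof.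
move=> p0; rewrite /opnorm; set E := [set _ | _ in _].
have Ea : E `|a|.
  by exists (delta_mx (Ordinal p0) 0); rewrite /= ?l2norm_scalar l2norm_delta ?mulr1.
have ubE : ubound E `|a|.
  by move=> _ [v /= v1 <-]; rewrite l2norm_scalar ler_piMr.
apply/le_anti/andP; split; first by apply: ge_sup => //; exists `|a|.
by apply: ub_le_sup => //; exists `|a|.
Qed.

Lemma adjoint_scalar (R : realType) (p : nat) (a : R) :
  (((a%:C)%:M : 'M[R[i]]_p)^t*)%sesqui = a%:C%:M.
Proof.
rewrite tr_scalar_mx map_scalar_mx /=.
by congr (_%:M); exact: conjc_real.
Qed.

Lemma invmx_real_scalar (R : realType) (p : nat) (a : R) :
  invmx (a%:C%:M : 'M[R[i]]_p) = (a^-1)%:C%:M.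
Proof. by rewrite invmx_scalar fmorphV. Qed.

Lemma mul_real_scalar (R : realType) (p : nat) (a b : R) :
  a%:C%:M *m b%:C%:M = (a * b)%:C%:M :> 'M[R[i]]_p.
Proof. by rewrite -scalar_mxM (rmorphM (real_complex R)). Qed.

(** Passing from [n] to [n + 2] keeps the parity of [n - k], so the old factors
    are untouched and only two new ones appear on the left. *)
Lemma alt_prodSS (R : realType) (p : nat) (B : nat -> 'M[R[i]]_p) (n : nat) :
  (0 < n)%N ->
  alt_prod B n.+2 = invmx (B n.+1) *m ((B n)^t*%sesqui *m alt_prod B n).
Proof.
case: n => // n _; rewrite /alt_prod /index_iota !subSS !subn0.
have -> : (iota 1 n.+2 = rcons (rcons (iota 1 n) n.+1) n.+2)%N.
  by rewrite -[in LHS]addn2 iotaD -!cats1 -catA.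
rewrite !rev_rcons !big_cons.
have -> : (n.+3 - n.+2 = 1)%N by lia.
have -> : (n.+3 - n.+1 = 2)%N by lia.
congr (_ *m (_ *m _)); apply: eq_big_seq => k.
rewrite mem_rev mem_iota => /andP[_ kn].
have -> : (n.+3 - k = (n.+1 - k).+2)%N by lia.
by rewrite /= negbK.
Qed.

Lemma alt_prod_scalar (R : realType) (p : nat) (B : nat -> 'M[R[i]]_p)
    (b : nat -> R) (j : nat) :
  (forall k, B k = (b k)%:C%:M) ->
  alt_prod B j.*2.+1 = (\prod_(i < j) (b i.*2.+1 / b i.*2.+2))%:C%:M.
Proof.
move=> Bb; elim: j => [|j IH].
  by rewrite /alt_prod /index_iota subn1 /= big_nil big_ord0.
rewrite doubleS alt_prodSS// IH !Bb adjoint_scalar invmx_real_scalar.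
rewrite !mul_real_scalar big_ord_recr /=; congr (_%:C%:M); ring.
Qed.

Definition offdiag_coef (R : realType) (c : R) (d : nat -> R) (n : nat) : R :=
  let j := n./2 in
  if odd n then nu c (d j.+1) / (d j.+1 `^ (3 / 2) * d j.+2 `^ (1 / 2))
  else nu c (d j.+1) / d j.+1 ^+ 2.

Lemma super_block_J (R : realType) (p : nat) (c : R) (d : nat -> R)
    (alpha : nat -> 'M[R[i]]_p) (n : nat) :
  super_block (J_X_alpha c d alpha) n = (offdiag_coef c d n)%:C%:M.
Proof.
rewrite /super_block /J_X_alpha /block_jacobi (ltn_eqF (ltnSn n)) eqxx.
by rewrite /J_offdiag /offdiag_coef; case: ifP.
Qed.

Lemma nu_gt0 (R : realType) (c x : R) : 0 < c -> 0 < x -> 0 < nu c x.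
Proof.
move=> c0 x0; rewrite /nu divr_gt0 ?mulr_gt0 ?sqrtr_gt0//.
by rewrite (lt_le_trans ltr01)// lerDl mulr_ge0 ?sqr_ge0.
Qed.

(** [x / nu c x] is [sqrt (1 + c^2 x^2) / c], and the root is at least 1. *)
Lemma div_nu_ge (R : realType) (c x : R) : 0 < c -> 0 < x -> c^-1 <= x / nu c x.
Proof.
move=> c0 x0; rewrite /nu.
have s1 : 1 <= Num.sqrt (1 + c ^+ 2 * x ^+ 2).
  by rewrite -[leLHS]sqrtr1 ler_wsqrtr// lerDl mulr_ge0 ?sqr_ge0.
have -> : x / (c * x / Num.sqrt (1 + c ^+ 2 * x ^+ 2)) =
          c^-1 * Num.sqrt (1 + c ^+ 2 * x ^+ 2).
  by field; rewrite !gt_eqF// (lt_le_trans ltr01 s1).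
by rewrite ler_peMr// invr_ge0 ltW.
Qed.

(** The half-integer powers in the odd entries are exactly what makes the ratio
    [B_{2i+1} / B_{2i+2}] equal to [q_{i+1} / q_{i+2}] with
    [q_i = nu (d_i) / d_i^{3/2}]: the stray [d_{i+2}^{1/2}] turns
    [d_{i+2}^2] into [d_{i+2}^{3/2}]. *)
Lemma offdiag_prod (R : realType) (c : R) (d : nat -> R) (j : nat) :
  0 < c -> (forall n, (1 <= n)%N -> 0 < d n) ->
  \prod_(i < j) (offdiag_coef c d i.*2.+1 / offdiag_coef c d i.*2.+2) =
  (nu c (d 1%N) / d 1%N `^ (3 / 2)) / (nu c (d j.+1) / d j.+1 `^ (3 / 2)).
Proof.
move=> c0 d0; have n0 k : nu c (d k.+1) != 0 by rewrite gt_eqF// nu_gt0// d0.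
have e0 k r : d k.+1 `^ r != 0 by rewrite gt_eqF// powR_gt0// d0.
elim: j => [|j IH].
  by rewrite big_ord0 divff// mulf_neq0 ?n0 ?invr_neq0 ?e0.
rewrite big_ord_recr /= IH /offdiag_coef /= !odd_double /= uphalf_double.
rewrite !doubleK.
have -> : d j.+2 ^+ 2 = d j.+2 `^ (3 / 2) * d j.+2 `^ (1 / 2).
  rewrite -powRD ?gt_eqF ?d0 ?implybT//.
  by rewrite -powR_mulrn ?ltW ?d0//; congr (_ `^ _); lra.
by field; rewrite !n0 !e0.
Qed.

(** Here [C^* A C] is a scalar matrix and [|C|^2 |A|] collapses to a constant
    times [d_{j+1} / nu (d_{j+1})], because [(d^{3/2} / nu)^2 * (nu / d^2)] is
    [d / nu]. *)
Lemma KM_term_odd (R : realType) (p : nat) (c : R) (d : nat -> R)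
    (alpha : nat -> 'M[R[i]]_p) (j : nat) :
  (0 < p)%N -> 0 < c -> (forall n, (1 <= n)%N -> 0 < d n) ->
  KM_term (J_X_alpha c d alpha) j.*2.+1 =
  (nu c (d 1%N) / d 1%N `^ (3 / 2)) ^+ 2 * (d j.+1 / nu c (d j.+1)).
Proof.
move=> p0 c0 d0; have dj : 0 < d j.+1 by exact: d0.
have nj : 0 < nu c (d j.+1) by exact: nu_gt0.
set q := nu c (d 1%N) / _; set r := q / (nu c (d j.+1) / d j.+1 `^ (3 / 2)).
have CE : KM_C (J_X_alpha c d alpha) j.*2.+1 = ((-1) ^+ j * r)%:C%:M.
  rewrite /KM_C /= uphalf_double (alt_prod_scalar _ (super_block_J c d alpha)).
  by rewrite offdiag_prod// scale_scalar_mx [in RHS](rmorphM (real_complex R))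
    rmorphXn rmorphN1.
have AE : diag_block (J_X_alpha c d alpha) j.*2.+1 =
          (- (nu c (d j.+1) / d j.+1 ^+ 2))%:C%:M.
  rewrite /diag_block /J_X_alpha /block_jacobi eqxx /J_diag /= odd_double /=.
  by rewrite uphalf_double.
rewrite /KM_term CE AE adjoint_scalar !mul_real_scalar opnorm_scalar//.
(* The sign of C_{2j+1} enters squared. *)
have -> : (-1) ^+ j * r * - (nu c (d j.+1) / d j.+1 ^+ 2) * ((-1) ^+ j * r) =
          - (((-1) ^+ j) ^+ 2 * (r ^+ 2 * (nu c (d j.+1) / d j.+1 ^+ 2))).
  by ring.
rewrite sqrr_sign mul1r normrN ger0_norm; last first.
  by rewrite mulr_ge0 ?sqr_ge0// divr_ge0 ?sqr_ge0 ?ltW.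
have e3 : (d j.+1 `^ (3 / 2)) ^+ 2 = d j.+1 ^+ 3.
  rewrite -[LHS]powR_mulrn ?powR_ge0// -powRrM -powR_mulrn ?ltW//.
  by congr (_ `^ _); lra.
have -> : r ^+ 2 = q ^+ 2 * d j.+1 ^+ 3 / nu c (d j.+1) ^+ 2.
  by rewrite -e3 /r; field; rewrite !gt_eqF ?powR_gt0.
by field; rewrite !gt_eqF.
Qed.

(** A convergent series has terms tending to 0; bounding those of odd index is
    enough, since every tail of the series contains one of them. *)
Lemma sum_diverges (R : realType) (u : nat -> R) (e : R) : 0 < e ->
  (forall j, e <= u j.*2.+1) -> ~ cvgn (fun N => \sum_(1 <= n < N) u n).
Proof.
move=> e0 ue /cvg_ex[/= l Sl].
have : (\sum_(1 <= n < N.+1) u n - \sum_(1 <= n < N) u n) @[N --> \oo] --> l - l.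
  by apply: cvgB => //; move: Sl; rewrite -cvg_shiftS.
rewrite subrr => /cvgrPdist_lt/(_ _ e0)[N _ /(_ N.*2.+1)].
rewrite /= sub0r normrN big_nat_recr//= [_ + u _]addrC addrK => small.
have /small : (N <= N.*2.+1)%N by lia.
by apply/negP; rewrite -leNgt (le_trans (ue N))// ler_norm.
Qed.

Lemma nneseries_lt_pinfty_cvg (R : realType) (u : nat -> R) (m : nat) :
  (forall n, 0 <= u n) -> (\sum_(m <= n <oo) (u n)%:E < +oo)%E ->
  cvgn (fun N => \sum_(m <= n < N) u n).
Proof.
move=> u0 uoo; apply: nondecreasing_is_cvgn.
  apply/nondecreasing_seqP => N; case: (leqP m N) => mN.
    by rewrite big_nat_recr//= lerDl.
  by rewrite !big_geq// ltnW.
exists (fine (\sum_(m <= n <oo) (u n)%:E)%E) => _ [N _ <-].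
have s0 : (0 <= \sum_(m <= n <oo) (u n)%:E)%E.
  by apply: nneseries_ge0 => n _ _; rewrite lee_fin.
rewrite -lee_fin fineK ?ge0_fin_numE// -sumEFin.
by apply: nneseries_lim_ge => n _ _; rewrite lee_fin.
Qed.

Theorem proposition9p2 (R : realType) (p : nat) (d : nat -> R) (c : R)
    (alpha : nat -> 'M[R[i]]_p)
    (hp : (0 < p)%N)
    (hd : forall n : nat, (1 <= n)%N -> 0 < d n)
    (hc : 0 < c)
    (halpha : forall n : nat, (1 <= n)%N -> alpha n \is hermsymmx) :
  ~ cvgn (fun N : nat => \sum_(1 <= n < N) KM_term (J_X_alpha c d alpha) n) /\
  ~ Kostyuchenko_Mirzoev (J_X_alpha c d alpha).
Proof.
have q0 : 0 < (nu c (d 1%N) / d 1%N `^ (3 / 2)) ^+ 2.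
  by rewrite exprn_gt0// divr_gt0 ?powR_gt0 ?nu_gt0 ?hd.
have div : ~ cvgn (fun N => \sum_(1 <= n < N) KM_term (J_X_alpha c d alpha) n).
  apply: (@sum_diverges _ _ ((nu c (d 1%N) / d 1%N `^ (3 / 2)) ^+ 2 / c)) => [|j].
    by rewrite divr_gt0.
  by rewrite KM_term_odd// ler_pM2l// div_nu_ge// hd.
split=> // -[_ finite_sum]; apply: div.
by apply: nneseries_lt_pinfty_cvg finite_sum => n; exact: opnorm_ge0.
Qed.
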